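(* Let $\varphi_e$ and $\varphi_{e_1}$ form a Mannheim surface offset, with dual Lorentzian offset angle $\bar\theta=\theta+\varepsilon\theta^*$. Then $\varphi_{e_1}$ is developable if and only if $$\theta^*=\frac{\delta}{\gamma}\coth\theta$$ holds.
   Context: Minkowski space $\mathbb{R}^3_1$ is $\mathbb{R}^3$ with $\langle \vec a,\vec b\rangle=-a_1b_1+a_2b_2+a_3b_3$, and the Lorentzian cross product is $\vec a\times\vec b=(a_2b_3-a_3b_2,\ a_1b_3-a_3b_1,\ a_2b_1-a_1b_2)$. Dual numbers are $a+\varepsilon a^*$ with $a,a^*\in\mathbb{R}$, $\varepsilon^2=0$; dual vectors are $\vec a+\varepsilon\vec a^*$ with $\vec a,\vec a^*\in\mathbb{R}^3_1$; inner and cross products extend bilinearly over the dual numbers. A differentiable real function $f$ extends to dual numbers by $f(x+\varepsilon x^* )=f(x)+\varepsilon x^*f'(x)$. First surface (spacelike ruled surface): $\varphi_e(s,v)=\vec c(s)+v\,\vec e(s)$ with $\langle\vec e,\vec e\rangle=1$, $\langle\vec e\,',\vec e\,'\rangle=-1$, $\langle\vec c\,',\vec e\,'\rangle=0$ (prime is $d/ds$; $s$ is the arc-length of the indicatrix $\vec e$, and $\vec c$ is the striction curve). Put $\vec t=\vec e\,'$, $\vec g=-\vec e\times\vec t$; then $\vec t\,'=\vec e+\gamma\vec g$, $\vec g\,'=\gamma\vec t$, which defines the conical curvature $\gamma$. Put $\Delta=\det(\vec c\,',\vec e,\vec t)$, $\delta=\langle\vec c\,',\vec e\rangle$, and $\tilde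 x=\vec x+\varepsilon\,\vec c\times\vec x$ for $\vec x=\vec e,\vec t,\vec g$. The dual arc-length is $\bar s=s+\varepsilon s^*$, $s^*=\int_0^s\Delta\,du$. The dual Darboux frame $\{\tilde e,\tilde t,\tilde g\}$ satisfies $\frac{d\tilde e}{d\bar s}=\tilde t$, $\frac{d\tilde t}{d\bar s}=\tilde e+\bar\gamma\tilde g$, $\frac{d\tilde g}{d\bar s}=\bar\gamma\tilde t$ with $\bar\gamma=\gamma-\varepsilon(\delta+\gamma\Delta)$. Second surface (timelike ruled surface with timelike rulings): $\varphi_{e_1}(s_1,v)=\vec c_1(s_1)+v\,\vec e_1(s_1)$ with $\langle\vec e_1,\vec e_1\rangle=-1$, $s_1$ the arc-length of the indicatrix $\vec e_1$, $\vec t_1=\frac{d\vec e_1}{ds_1}$ with $\langle\vec t_1,\vec t_1\rangle=1$, $\langle\frac{d\vec c_1}{ds_1},\vec t_1\rangle=0$ ($\vec c_1$ is the striction curve). Put $\Delta_1=\det(\frac{d\vec c_1}{ds_1},\vec e_1,\vec t_1)$. The surface $\varphi_{e_1}$ is developable if and only if $\Delta_1=0$. Its dual arc-length is $\bar s_1=s_1+\varepsilon s_1^*$, $s_1^*=-\int_0^{s_1}\Delta_1du_1$. Its dual Darboux frame is $\{\tilde e_1,\tilde t_1,\tilde g_1\}$, $\tilde x_1=\vec x_1+\varepsilon\,\vec c_1\times\vec x_1$, with $\tilde t_1=\frac{d\tilde e_1}{d\bar s_1}$. Mannheim offsets: $\varphi_e$ and $\varphi_{e_1}$ form a Mannheim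 surface offset if $\tilde g(\bar s)=\tilde t_1(\bar s_1)$ at corresponding parameters. The frames are then related by $$\tilde e_1=\sinh\bar\theta\,\tilde e+\cosh\bar\theta\,\tilde t,\quad \tilde t_1=\tilde g,\quad \tilde g_1=\cosh\bar\theta\,\tilde e+\sinh\bar\theta\,\tilde t,$$ where $\bar\theta=\theta+\varepsilon\theta^*$ ($\theta,\theta^*$ real) is the dual Lorentzian offset angle between $\tilde e$ and $\tilde e_1$; $\theta$ is called the offset angle (the angle between the rulings $\vec e$ and $\vec e_1$) and $\theta^*$ the offset distance (measured from the striction point $\vec c$ of $\varphi_e$ to the striction point $\vec c_1$ of $\varphi_{e_1}$). Quantities of the two surfaces are compared at corresponding parameters $s$, $s_1$. *)

(* Defs.v *)
From Stdlib Require Import Reals.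
From Coquelicot Require Import Coquelicot.
Open Scope R_scope.

(* [plus], [scal], [opp], [zero] on vectors, dual numbers and dual vectors are
   Coquelicot's operations on product modules. *)
Definition vec : Type := (R * R * R)%type.

Definition v1 (a : vec) : R := fst (fst a).
Definition v2 (a : vec) : R := snd (fst a).
Definition v3 (a : vec) : R := snd a.

(* Minkowski space R^3_1, the first coordinate being the timelike one. *)
Definition inner (a b : vec) : R :=
  - (v1 a * v1 b) + v2 a * v2 b + v3 a * v3 b.

Definition cross (a b : vec) : vec :=
  (v2 a * v3 b - v3 a * v2 b,
   v1 a * v3 b - v3 a * v1 b,
   v2 a * v1 b - v1 a * v2 b).

Definition det3 (a b c : vec) : R :=
  v1 a * (v2 b * v3 c - v3 b * v2 c)
  - v2 a * (v1 b * v3 c - v3 b * v1 c)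
  + v3 a * (v1 b * v2 c - v2 b * v1 c).

Definition vDerive (f : R -> vec) (s : R) : vec :=
  (Derive (fun u => v1 (f u)) s,
   Derive (fun u => v2 (f u)) s,
   Derive (fun u => v3 (f u)) s).

Definition open_interval (I : R -> Prop) : Prop :=
  exists a b : Rbar, Rbar_lt a b /\
    forall s : R, I s <-> (Rbar_lt a s /\ Rbar_lt s b).

Definition class_C (n : nat) (I : R -> Prop) (f : R -> R) : Prop :=
  forall (k : nat) (s : R), (k <= n)%nat -> I s ->
    ex_derive_n f k s /\ continuous (Derive_n f k) s.

Definition vclass_C (n : nat) (I : R -> Prop) (f : R -> vec) : Prop :=
  class_C n I (fun s => v1 (f s)) /\
  class_C n I (fun s => v2 (f s)) /\
  class_C n I (fun s => v3 (f s)).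

(* The pair (a, b) stands for a + eps b; likewise for dual vectors. *)
Definition dual : Type := (R * R)%type.
Definition dvec : Type := (vec * vec)%type.

Definition dual_ext (f : R -> R) (x : dual) : dual :=
  (f (fst x), snd x * Derive f (fst x)).

Definition dscal (a : dual) (x : dvec) : dvec :=
  (scal (fst a) (fst x),
   plus (scal (fst a) (snd x)) (scal (snd a) (fst x))).

(* Meaningful only for [x <> 0]. *)
Definition coth (x : R) : R := cosh x / sinh x.

(* The curves are total functions, but only their values on [param_domain] matter. *)
Record ruled_surface : Type := RuledSurface {
  param_domain : R -> Prop;
  striction : R -> vec;
  ruling : R -> vec
}.

Definition surface_map (S : ruled_surface) (s v : R) : vec :=
  plus (striction S s) (scal v (ruling S s)).

Definition regular_surface (S : ruled_surface) : Prop :=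
  open_interval (param_domain S) /\
  vclass_C 1 (param_domain S) (striction S) /\
  vclass_C 2 (param_domain S) (ruling S).

Definition tvec (S : ruled_surface) (s : R) : vec := vDerive (ruling S) s.

Definition gvec (S : ruled_surface) (s : R) : vec :=
  opp (cross (ruling S s) (tvec S s)).

(* Delta, or Delta_1 for the second surface. *)
Definition Delta (S : ruled_surface) (s : R) : R :=
  det3 (vDerive (striction S) s) (ruling S s) (tvec S s).

Definition delta (S : ruled_surface) (s : R) : R :=
  inner (vDerive (striction S) s) (ruling S s).

(* In the next two definitions the causal characters of e and t make s the
   arc-length of the indicatrix, and the last equation says that the base curve
   is the striction curve. *)
Definition spacelike_ruled (S : ruled_surface) : Prop :=
  regular_surface S /\
  forall s : R, param_domain S s ->
    inner (ruling S s) (ruling S s) = 1 /\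
    inner (tvec S s) (tvec S s) = -1 /\
    inner (vDerive (striction S) s) (tvec S s) = 0.

Definition timelike_ruled (S : ruled_surface) : Prop :=
  regular_surface S /\
  forall s : R, param_domain S s ->
    inner (ruling S s) (ruling S s) = -1 /\
    inner (tvec S s) (tvec S s) = 1 /\
    inner (vDerive (striction S) s) (tvec S s) = 0.

Definition conical_curvature (S : ruled_surface) (gamma : R -> R) : Prop :=
  forall s : R, param_domain S s ->
    vDerive (tvec S) s = plus (ruling S s) (scal (gamma s) (gvec S s)) /\
    vDerive (gvec S) s = scal (gamma s) (tvec S s).

Definition surface_ds (S : ruled_surface) (s v : R) : vec :=
  vDerive (fun u => surface_map S u v) s.

Definition surface_dv (S : ruled_surface) (s v : R) : vec :=
  vDerive (fun w => surface_map S s w) v.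

Definition regular_point (S : ruled_surface) (s v : R) : Prop :=
  cross (surface_ds S s v) (surface_dv S s v) <> zero.

Definition tangent_plane (S : ruled_surface) (s v : R) (x : vec) : Prop :=
  exists a b : R,
    x = plus (scal a (surface_ds S s v)) (scal b (surface_dv S s v)).

(* The tangent plane is the same at all regular points of a ruling.  For
   surfaces as in [spacelike_ruled] or [timelike_ruled] this is equivalent to
   the vanishing of [Delta] on [param_domain S]. *)
Definition developable (S : ruled_surface) : Prop :=
  forall s v w : R, param_domain S s ->
    regular_point S s v -> regular_point S s w ->
    forall x : vec, tangent_plane S s v x <-> tangent_plane S s w x.

(* The dual vector [x + eps cross c x] of the line through c(s) with direction x(s). *)
Definition dual_line (S : ruled_surface) (x : R -> vec) (s : R) : dvec :=
  (x s, cross (striction S s) (x s)).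

Definition dual_e (S : ruled_surface) : R -> dvec := dual_line S (ruling S).
Definition dual_t (S : ruled_surface) : R -> dvec := dual_line S (tvec S).
Definition dual_g (S : ruled_surface) : R -> dvec := dual_line S (gvec S).

(* s1 = sigma s is a regular change of parameter from [param_domain S] onto
   [param_domain S1]; it is injective because its derivative has no zero on the
   interval. *)
Definition corresponding_parameters
    (S S1 : ruled_surface) (sigma : R -> R) : Prop :=
  (forall s, param_domain S s -> param_domain S1 (sigma s)) /\
  (forall s1, param_domain S1 s1 -> exists s, param_domain S s /\ sigma s = s1) /\
  (forall s, param_domain S s -> ex_derive sigma s /\ Derive sigma s <> 0).

Definition mannheim_offset (S S1 : ruled_surface) (sigma : R -> R) : Prop :=
  corresponding_parameters S S1 sigma /\
  forall s, param_domain S s -> dual_g S s = dual_t S1 (sigma s).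

Definition dual_offset_angle
    (S S1 : ruled_surface) (sigma : R -> R) (theta : R -> dual) : Prop :=
  forall s, param_domain S s ->
    dual_e S1 (sigma s) =
      plus (dscal (dual_ext sinh (theta s)) (dual_e S s))
           (dscal (dual_ext cosh (theta s)) (dual_t S s)) /\
    dual_g S1 (sigma s) =
      plus (dscal (dual_ext cosh (theta s)) (dual_e S s))
           (dscal (dual_ext sinh (theta s)) (dual_t S s)).

(* Main.v *)
Require Import Defs.
From Stdlib Require Import Reals Lra Lia.
From Coquelicot Require Import Coquelicot.
Open Scope R_scope.

(** Write [d = c1 - c].  The dual parts of the frame relations say that [d] is
    orthogonal to [e] and [t] and that [<d, g> = thetastar].  With
    [g1 = cosh theta e + sinh theta t] and [Delta1 = <c1', g1>],
    differentiating [<d, e> = <d, t> = 0] gives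
    [sigma' Delta1 = cosh theta delta - sinh theta gamma thetastar], and
    differentiating [<e1, g> = 0] gives [sigma' = gamma cosh theta], so that
    [gamma] does not vanish.  This settles the points where [theta <> 0].  At a
    zero of [theta] one uses that [sinh theta = <e1, e>] has derivative
    [- cosh theta <> 0], so such zeros are isolated, and that [Delta1] is
    continuous. *)

(** * Coordinates and the algebra of the Lorentzian products *)

Lemma v1_plus (a b : vec) : v1 (plus a b) = v1 a + v1 b.
Proof. reflexivity. Qed.
Lemma v2_plus (a b : vec) : v2 (plus a b) = v2 a + v2 b.
Proof. reflexivity. Qed.
Lemma v3_plus (a b : vec) : v3 (plus a b) = v3 a + v3 b.
Proof. reflexivity. Qed.
Lemma v1_scal (k : R) (a : vec) : v1 (scal k a) = k * v1 a.
Proof. reflexivity. Qed.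
Lemma v2_scal (k : R) (a : vec) : v2 (scal k a) = k * v2 a.
Proof. reflexivity. Qed.
Lemma v3_scal (k : R) (a : vec) : v3 (scal k a) = k * v3 a.
Proof. reflexivity. Qed.
Lemma v1_opp (a : vec) : v1 (opp a) = - v1 a.
Proof. reflexivity. Qed.
Lemma v2_opp (a : vec) : v2 (opp a) = - v2 a.
Proof. reflexivity. Qed.
Lemma v3_opp (a : vec) : v3 (opp a) = - v3 a.
Proof. reflexivity. Qed.
Lemma v1_zero : v1 zero = 0.
Proof. reflexivity. Qed.
Lemma v2_zero : v2 zero = 0.
Proof. reflexivity. Qed.
Lemma v3_zero : v3 zero = 0.
Proof. reflexivity. Qed.
Lemma v1_cross (a b : vec) : v1 (cross a b) = v2 a * v3 b - v3 a * v2 b.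
Proof. reflexivity. Qed.
Lemma v2_cross (a b : vec) : v2 (cross a b) = v1 a * v3 b - v3 a * v1 b.
Proof. reflexivity. Qed.
Lemma v3_cross (a b : vec) : v3 (cross a b) = v2 a * v1 b - v1 a * v2 b.
Proof. reflexivity. Qed.

Lemma vec_eq (a b : vec) : v1 a = v1 b -> v2 a = v2 b -> v3 a = v3 b -> a = b.
Proof.
  destruct a as [[a1 a2] a3], b as [[b1 b2] b3]; unfold v1, v2, v3; simpl.
  now intros -> -> ->.
Qed.

Ltac vec_coords :=
  unfold inner, det3;
  repeat rewrite ?v1_plus, ?v2_plus, ?v3_plus, ?v1_scal, ?v2_scal, ?v3_scal,
    ?v1_opp, ?v2_opp, ?v3_opp, ?v1_cross, ?v2_cross, ?v3_cross,
    ?v1_zero, ?v2_zero, ?v3_zero.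

Ltac vec_ring :=
  intros; first [apply vec_eq; vec_coords; ring | vec_coords; ring].

Lemma inner_sym (a b : vec) : inner a b = inner b a.
Proof. vec_ring. Qed.

Lemma inner_plus_l (a b c : vec) : inner (plus a b) c = inner a c + inner b c.
Proof. vec_ring. Qed.

Lemma inner_scal_l (k : R) (a b : vec) : inner (scal k a) b = k * inner a b.
Proof. vec_ring. Qed.

Lemma inner_opp_l (a b : vec) : inner (opp a) b = - inner a b.
Proof. vec_ring. Qed.

Lemma inner_plus_r (a b c : vec) : inner a (plus b c) = inner a b + inner a c.
Proof. vec_ring. Qed.

Lemma inner_scal_r (k : R) (a b : vec) : inner a (scal k b) = k * inner a b.
Proof. vec_ring. Qed.

Lemma inner_opp_r (a b : vec) : inner a (opp b) = - inner a b.
Proof. vec_ring. Qed.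

Lemma inner_zero_l (a : vec) : inner zero a = 0.
Proof. vec_ring. Qed.

Ltac inner_lin :=
  repeat rewrite ?inner_plus_l, ?inner_plus_r, ?inner_scal_l, ?inner_scal_r,
    ?inner_opp_l, ?inner_opp_r.

Lemma inner_cross_det (a b c : vec) : inner a (opp (cross b c)) = det3 a b c.
Proof. vec_ring. Qed.

Lemma inner_cross_l (a b : vec) : inner a (cross a b) = 0.
Proof. vec_ring. Qed.

Lemma inner_cross_r (a b : vec) : inner b (cross a b) = 0.
Proof. vec_ring. Qed.

(** The triple product expansion, and after it Lagrange's identity; in this signature both carry the
    sign opposite to the Euclidean one. *)
Lemma cross_cross (a b c : vec) :
  cross (cross a b) c = plus (scal (inner b c) a) (scal (- inner a c) b).
Proof. vec_ring. Qed.

Lemma inner_cross_cross (a b c d : vec) :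
  inner (cross a b) (cross c d) = inner a d * inner b c - inner a c * inner b d.
Proof. vec_ring. Qed.

(** With [n = cross e t], expanding [cross n q] gives zero because [q] is orthogonal to [e] and [t].
    Expanding [cross (cross n q) n] then leaves [<q,n> n - <n,n> q = 0]. *)
Lemma orthogonal_to_pair (e t q : vec) :
  inner q e = 0 -> inner q t = 0 ->
  inner (cross e t) (cross e t) = 1 ->
  q = scal (inner q (cross e t)) (cross e t).
Proof.
  intros He Ht Hn.
  assert (H0 : cross (cross e t) q = zero).
  { rewrite cross_cross, (inner_sym t), (inner_sym e), He, Ht.
    vec_ring. }
  assert (H1 := cross_cross (cross e t) q (cross e t)).
  rewrite H0, Hn in H1.
  set (k := inner q (cross e t)) in *; set (n := cross e t) in *.
  apply vec_eq;
    [apply (f_equal v1) in H1; revert H1 | apply (f_equal v2) in H1; revert H1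
    | apply (f_equal v3) in H1; revert H1]; vec_coords; lra.
Qed.

(** * Derivatives of vector-valued functions *)

(** [vDerive] has a value even where a coordinate is not differentiable, so differentiability is
    carried by a relation. *)
Definition is_vderive (f : R -> vec) (s : R) (l : vec) : Prop :=
  is_derive (fun u => v1 (f u)) s (v1 l) /\
  is_derive (fun u => v2 (f u)) s (v2 l) /\
  is_derive (fun u => v3 (f u)) s (v3 l).

Lemma is_vderive_unique (f : R -> vec) (s : R) (l : vec) :
  is_vderive f s l -> vDerive f s = l.
Proof.
  intros (H1 & H2 & H3); apply vec_eq; apply is_derive_unique; assumption.
Qed.

Lemma is_vderive_minus (f g : R -> vec) (s : R) (l m : vec) :
  is_vderive f s l -> is_vderive g s m ->
  is_vderive (fun u => plus (f u) (opp (g u))) s (plus l (opp m)).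
Proof.
  intros (F1 & F2 & F3) (G1 & G2 & G3).
  split; [| split];
    [ exact (is_derive_minus _ _ _ _ _ F1 G1)
    | exact (is_derive_minus _ _ _ _ _ F2 G2)
    | exact (is_derive_minus _ _ _ _ _ F3 G3) ].
Qed.

Lemma is_vderive_comp (f : R -> vec) (h : R -> R) (s k : R) (l : vec) :
  is_vderive f (h s) l -> is_derive h s k ->
  is_vderive (fun u => f (h u)) s (scal k l).
Proof.
  intros (F1 & F2 & F3) H.
  split; [| split];
    [ exact (is_derive_comp _ _ _ _ _ F1 H)
    | exact (is_derive_comp _ _ _ _ _ F2 H)
    | exact (is_derive_comp _ _ _ _ _ F3 H) ].
Qed.

Lemma is_derive_Rmult (f g : R -> R) (s l m : R) :
  is_derive f s l -> is_derive g s m ->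
  is_derive (fun u => f u * g u) s (l * g s + f s * m).
Proof.
  intros F G; apply (is_derive_mult f g s l m F G); intros; apply Rmult_comm.
Qed.

Lemma is_derive_inner (f g : R -> vec) (s : R) (l m : vec) :
  is_vderive f s l -> is_vderive g s m ->
  is_derive (fun u => inner (f u) (g u)) s (inner l (g s) + inner (f s) m).
Proof.
  intros (F1 & F2 & F3) (G1 & G2 & G3).
  pose proof (is_derive_opp _ _ _ (is_derive_Rmult _ _ _ _ _ F1 G1)) as H1.
  pose proof (is_derive_Rmult _ _ _ _ _ F2 G2) as H2.
  pose proof (is_derive_Rmult _ _ _ _ _ F3 G3) as H3.
  pose proof (is_derive_plus _ _ _ _ _ (is_derive_plus _ _ _ _ _ H1 H2) H3) as H.
  evar_last; [exact H |].
  unfold inner, plus, opp; simpl; ring.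
Qed.

Lemma is_vderive_opp_cross (f g : R -> vec) (s : R) (l m : vec) :
  is_vderive f s l -> is_vderive g s m ->
  is_vderive (fun u => opp (cross (f u) (g u))) s
    (opp (plus (cross l (g s)) (cross (f s) m))).
Proof.
  intros (F1 & F2 & F3) (G1 & G2 & G3).
  assert (aux : forall p q p' q' : R -> R, forall a b a' b' r : R,
    is_derive p s a -> is_derive q s b -> is_derive p' s a' -> is_derive q' s b' ->
    r = - ((a * q s + p s * b) - (a' * q' s + p' s * b')) ->
    is_derive (fun u => - (p u * q u - p' u * q' u)) s r).
  { intros p q p' q' a b a' b' r P Q P' Q' ->.
    exact (is_derive_opp _ _ _ (is_derive_minus _ _ _ _ _
      (is_derive_Rmult _ _ _ _ _ P Q) (is_derive_Rmult _ _ _ _ _ P' Q'))). }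
  split; [| split]; (eapply aux; [eassumption .. | vec_coords; ring]).
Qed.

(** The product rule for an inner product that is known to be constant only on [I], hence compared
    with a constant only near [s]. *)
Lemma derive_inner_const (I : R -> Prop) (f g : R -> vec) (s k : R) (l m : vec) :
  locally s I -> (forall u, I u -> inner (f u) (g u) = k) ->
  is_vderive f s l -> is_vderive g s m ->
  inner l (g s) + inner (f s) m = 0.
Proof.
  intros HI Hk Hf Hg.
  rewrite <- (is_derive_unique _ _ _ (is_derive_inner _ _ _ _ _ Hf Hg)).
  rewrite (Derive_ext_loc _ (fun _ => k)).
  - apply Derive_const.
  - exact (filter_imp _ _ Hk HI).
Qed.

(** * Regularity on the parameter interval *)

Lemma open_interval_locally (I : R -> Prop) (s : R) :
  Defs.open_interval I -> I s -> locally s I.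
Proof.
  intros (a & b & _ & Hab) Hs.
  apply Hab in Hs as [Ha Hb].
  apply (filter_imp (fun u : R => Rbar_lt a u /\ Rbar_lt u b)).
  - intros u Hu; now apply Hab.
  - apply filter_and; [exact (open_Rbar_gt' s a Ha) | exact (open_Rbar_lt' s b Hb)].
Qed.

Lemma vclass_C_derive (n : nat) (I : R -> Prop) (f : R -> vec) (s : R) :
  (1 <= n)%nat -> vclass_C n I f -> I s -> is_vderive f s (vDerive f s).
Proof.
  intros Hn (H1 & H2 & H3) Hs.
  split; [| split]; apply Derive_correct;
    [ exact (proj1 (H1 1%nat s Hn Hs))
    | exact (proj1 (H2 1%nat s Hn Hs))
    | exact (proj1 (H3 1%nat s Hn Hs)) ].
Qed.

Lemma vclass_C_vDerive (n : nat) (I : R -> Prop) (f : R -> vec) :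
  (2 <= n)%nat -> vclass_C n I f -> forall s, I s ->
  is_vderive (vDerive f) s (vDerive (vDerive f) s).
Proof.
  intros Hn (H1 & H2 & H3) s Hs.
  split; [| split]; apply Derive_correct;
    [ exact (proj1 (H1 2%nat s Hn Hs))
    | exact (proj1 (H2 2%nat s Hn Hs))
    | exact (proj1 (H3 2%nat s Hn Hs)) ].
Qed.

Definition vcontinuous (f : R -> vec) (s : R) : Prop :=
  continuous (fun u => v1 (f u)) s /\
  continuous (fun u => v2 (f u)) s /\
  continuous (fun u => v3 (f u)) s.

Lemma vclass_C_continuous (n : nat) (I : R -> Prop) (f : R -> vec) (s : R) :
  vclass_C n I f -> I s -> vcontinuous f s.
Proof.
  intros (H1 & H2 & H3) Hs.
  split; [| split];
    [ exact (proj2 (H1 0%nat s (Nat.le_0_l n) Hs))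
    | exact (proj2 (H2 0%nat s (Nat.le_0_l n) Hs))
    | exact (proj2 (H3 0%nat s (Nat.le_0_l n) Hs)) ].
Qed.

Lemma vclass_C_vDerive_continuous (n : nat) (I : R -> Prop) (f : R -> vec) (s : R) :
  (1 <= n)%nat -> vclass_C n I f -> I s -> vcontinuous (vDerive f) s.
Proof.
  intros Hn (H1 & H2 & H3) Hs.
  split; [| split];
    [ exact (proj2 (H1 1%nat s Hn Hs))
    | exact (proj2 (H2 1%nat s Hn Hs))
    | exact (proj2 (H3 1%nat s Hn Hs)) ].
Qed.

Lemma continuous_det3 (f g h : R -> vec) (s : R) :
  vcontinuous f s -> vcontinuous g s -> vcontinuous h s ->
  continuous (fun u => det3 (f u) (g u) (h u)) s.
Proof.
  intros (F1 & F2 & F3) (G1 & G2 & G3) (H1 & H2 & H3).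
  assert (minor : forall p q p' q' r : R -> R,
    continuous p s -> continuous q s -> continuous p' s -> continuous q' s ->
    continuous r s ->
    continuous (fun u => r u * (p u * q u - p' u * q' u)) s).
  { intros p q p' q' r P Q P' Q' K.
    exact (continuous_mult _ _ _ K (continuous_minus _ _ _
      (continuous_mult _ _ _ P Q) (continuous_mult _ _ _ P' Q'))). }
  exact (continuous_plus _ _ _
    (continuous_minus _ _ _
      (minor _ _ _ _ _ G2 H3 G3 H2 F1) (minor _ _ _ _ _ G1 H3 G3 H1 F2))
    (minor _ _ _ _ _ G1 H2 G2 H1 F3)).
Qed.

Lemma regular_surface_Delta_continuous (S : ruled_surface) (s : R) :
  regular_surface S -> param_domain S s -> continuous (Defs.Delta S) s.
Proof.
  intros (_ & Hc & He) Hs.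
  apply continuous_det3.
  - exact (vclass_C_vDerive_continuous 1 _ _ s (le_n 1) Hc Hs).
  - exact (vclass_C_continuous 2 _ _ s He Hs).
  - apply (vclass_C_vDerive_continuous 2 _ _ s) with (2 := He); [lia | exact Hs].
Qed.

(** * Tangent planes and developability *)

Lemma Delta_inner_gvec (S : ruled_surface) (s : R) :
  Defs.Delta S s = inner (vDerive (striction S) s) (gvec S s).
Proof. symmetry; apply inner_cross_det. Qed.

Lemma surface_ds_eq (S : ruled_surface) (s v : R) :
  regular_surface S -> param_domain S s ->
  surface_ds S s v = plus (vDerive (striction S) s) (scal v (tvec S s)).
Proof.
  intros (_ & Hc & He) Hs.
  destruct (vclass_C_derive 1 _ _ s (le_n 1) Hc Hs) as (C1 & C2 & C3).
  assert (E := vclass_C_derive 2 _ _ s (Nat.le_succ_diag_r 1) He Hs).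
  destruct E as (E1 & E2 & E3).
  apply is_vderive_unique.
  split; [| split];
    [ exact (is_derive_plus _ _ _ _ _ C1 (is_derive_scal _ _ v _ E1))
    | exact (is_derive_plus _ _ _ _ _ C2 (is_derive_scal _ _ v _ E2))
    | exact (is_derive_plus _ _ _ _ _ C3 (is_derive_scal _ _ v _ E3)) ].
Qed.

Lemma surface_dv_eq (S : ruled_surface) (s v : R) :
  surface_dv S s v = ruling S s.
Proof.
  apply is_vderive_unique.
  assert (aux : forall a b : R, is_derive (fun w : R => a + w * b) v b).
  { intros a b; auto_derive; [exact I | ring]. }
  split; [| split]; apply aux.
Qed.

(** Differentiating [<e,e> = k] gives [2 <e,t> = 0]. *)
Lemma inner_e_t (S : ruled_surface) (k s : R) :
  regular_surface S -> (forall u, param_domain S u -> inner (ruling S u) (ruling S u) = k) ->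
  param_domain S s -> inner (ruling S s) (tvec S s) = 0.
Proof.
  intros (HI & _ & He) Hk Hs.
  assert (E := vclass_C_derive 2 _ _ s (Nat.le_succ_diag_r 1) He Hs).
  assert (H := derive_inner_const _ _ _ s k _ _
    (open_interval_locally _ s HI Hs) Hk E E).
  fold (tvec S s) in H; rewrite (inner_sym (tvec S s)) in H; lra.
Qed.

(** If [Delta] is nonzero at [s], the whole ruling is regular and [c'] lies in the tangent plane at
    [v = 0] but not in the one at [v = 1]. If [Delta] vanishes, [c'] is parallel to [e], and every
    regular point of the ruling has the plane spanned by [e] and [t]. *)
Lemma timelike_developable (S : ruled_surface) :
  timelike_ruled S ->
  (developable S <-> forall s, param_domain S s -> Defs.Delta S s = 0).
Proof.
  intros (Hreg & HS).
  assert (Het : forall s, param_domain S s -> inner (ruling S s) (tvec S s) = 0).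
  { intros s Hs; apply (inner_e_t S (-1) s Hreg); [apply HS | exact Hs]. }
  split.
  - intros Hdev s Hs.
    destruct (Req_dec (Defs.Delta S s) 0) as [| HD]; [assumption | exfalso].
    assert (Hr : forall v, regular_point S s v).
    (* Pairing the normal with [t] kills the term in [v] and leaves [- Delta]. *)
    { intros v H0; unfold regular_point in H0.
      rewrite surface_ds_eq, surface_dv_eq in H0 by assumption.
      apply HD; unfold Defs.Delta.
      rewrite <- Ropp_0, <- (inner_zero_l (tvec S s)), <- H0, inner_sym.
      vec_ring. }
    destruct (proj1 (Hdev s 0 1 Hs (Hr 0) (Hr 1) (vDerive (striction S) s)))
      as (a & b & Hab).
    { exists 1, 0; rewrite surface_ds_eq, surface_dv_eq by assumption.
      vec_ring. }
    rewrite surface_ds_eq, surface_dv_eq in Hab by assumption.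
    destruct (HS s Hs) as (_ & Htt & Hpt).
    (* From [c' = a (c' + t) + b e], pairing with [t] gives [a = 0], and pairing with [g] gives
       [Delta = a Delta]. *)
    assert (Hg := f_equal (fun x => inner x (gvec S s)) Hab).
    assert (Ht := f_equal (fun x => inner x (tvec S s)) Hab).
    cbv beta in Hg, Ht; revert Hg Ht; inner_lin.
    rewrite <- Delta_inner_gvec, Hpt, Htt, (Het s Hs).
    unfold gvec; rewrite !inner_opp_r, inner_cross_l, inner_cross_r.
    intros Hg Ht; apply HD.
    replace a with 0 in Hg by lra; lra.
  - intros HD.
    assert (Hplane : forall s v w x, param_domain S s ->
      regular_point S s w -> tangent_plane S s v x -> tangent_plane S s w x).
    { intros s v w x Hs Hw.
      destruct (HS s Hs) as (Hee & Htt & Hpt).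
      set (p := vDerive (striction S) s) in *.
      assert (Hp : p = scal (- inner p (ruling S s)) (ruling S s)).
      (* As [<e,e> = -1], this [q] is the part of [c'] orthogonal to [e]. It is also orthogonal to
         [t], hence a multiple of [cross e t], with coefficient [- Delta = 0]. *)
      { set (q := plus p (scal (inner p (ruling S s)) (ruling S s))).
        assert (Hq : q = scal (inner q (cross (ruling S s) (tvec S s)))
                              (cross (ruling S s) (tvec S s))).
        { apply orthogonal_to_pair; unfold q; inner_lin.
          - rewrite Hee; ring.
          - rewrite Hpt, (Het s Hs); ring.
          - rewrite inner_cross_cross, Hee, Htt, (inner_sym (tvec S s)), (Het s Hs).
            ring. }
        assert (Hz : inner q (cross (ruling S s) (tvec S s)) = 0).
        { assert (H := HD s Hs); rewrite Delta_inner_gvec in H.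
          unfold gvec in H; rewrite inner_opp_r in H; fold p in H.
          unfold q; inner_lin; rewrite inner_cross_l; lra. }
        rewrite Hz in Hq; unfold q in Hq.
        apply vec_eq;
          [apply (f_equal v1) in Hq | apply (f_equal v2) in Hq
          | apply (f_equal v3) in Hq]; revert Hq;
          rewrite ?v1_plus, ?v2_plus, ?v3_plus, ?v1_scal, ?v2_scal, ?v3_scal; lra. }
      set (k := - inner p (ruling S s)) in *; clearbody k.
      unfold regular_point, tangent_plane in *.
      rewrite !surface_dv_eq, !surface_ds_eq in * by assumption.
      fold p in Hw |- *; rewrite Hp in Hw |- *.
      (* Now [c' = k e], so at [w = 0] both partial derivatives are parallel to [e] and the point is
         singular. *)
      assert (Hw0 : w <> 0).
      { intros ->; apply Hw; vec_ring. }
      intros (a & b & ->).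
      (* The first coefficient matches the [t] components of [a (k e + v t) + b e]; the second
         corrects the [e] components. *)
      exists (a * v / w), (a * k + b - a * v / w * k).
      apply vec_eq; vec_coords; field; exact Hw0. }
    intros s v w Hs Hv Hw x; split; apply Hplane; assumption.
Qed.

(** * Hyperbolic functions *)

Lemma cosh_sqr_minus_sinh_sqr (x : R) : cosh x * cosh x - sinh x * sinh x = 1.
Proof.
  unfold cosh, sinh.
  assert (H : exp x * exp (- x) = 1) by (rewrite <- exp_plus, Rplus_opp_r; apply exp_0).
  lra.
Qed.

Lemma cosh_neq_0 (x : R) : cosh x <> 0.
Proof.
  intros H; assert (H1 := cosh_sqr_minus_sinh_sqr x); rewrite H in H1.
  assert (H2 := Rle_0_sqr (sinh x)); unfold Rsqr in H2; lra.
Qed.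

Lemma sinh_eq_0 (x : R) : sinh x = 0 -> x = 0.
Proof.
  intros H; destruct (Rtotal_order x 0) as [Hx | [Hx | Hx]]; [| exact Hx |];
    apply sinh_lt in Hx; rewrite sinh_0 in Hx; lra.
Qed.

Lemma Derive_sinh (x : R) : Derive sinh x = cosh x.
Proof. apply is_derive_unique, is_derive_Reals, derivable_pt_lim_sinh. Qed.

Lemma Derive_cosh (x : R) : Derive cosh x = sinh x.
Proof. apply is_derive_unique, is_derive_Reals, derivable_pt_lim_cosh. Qed.

(** * Dual frames and the displacement between striction points *)

Lemma dual_combination (a b : dual) (x y z : dvec) :
  z = plus (dscal a x) (dscal b y) ->
  fst z = plus (scal (fst a) (fst x)) (scal (fst b) (fst y)) /\
  snd z = plus (plus (scal (fst a) (snd x)) (scal (snd a) (fst x)))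
               (plus (scal (fst b) (snd y)) (scal (snd b) (fst y))).
Proof. intros ->; split; reflexivity. Qed.

(* The algebra of two dual frames at a single point; primes denote the second one. *)
Lemma frame_displacement (c c' e t e' : vec) (sh ch k : R) :
  inner e e = 1 -> inner t t = -1 -> inner e t = 0 -> ch * ch - sh * sh = 1 ->
  e' = plus (scal sh e) (scal ch t) ->
  cross c' (opp (cross e t)) = cross c (opp (cross e t)) ->
  cross c' e' = plus (plus (scal sh (cross c e)) (scal (k * ch) e))
                     (plus (scal ch (cross c t)) (scal (k * sh) t)) ->
  let d := plus c' (opp c) in
  inner d e = 0 /\ inner d t = 0 /\ inner d (opp (cross e t)) = k.
Proof.
  intros Hee Htt Het Hch He' Hg Hk d.
  set (n := cross e t) in *.
  assert (Hnn : inner n n = 1).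
  { unfold n; rewrite inner_cross_cross, Hee, Htt, (inner_sym t), Het; ring. }
  (* The two lines with common direction [- n] have equal moments, so [d] is parallel to [n]. *)
  assert (Hdn : cross d n = zero).
  { assert (H : cross d n = plus (opp (cross c' (opp n))) (cross c (opp n)))
      by (unfold d; vec_ring).
    rewrite H, Hg; vec_ring. }
  (* For [x] orthogonal to [n], expanding [cross (cross d n) x = 0] leaves [<d,x> n = 0]; pairing
     with the unit vector [n] finishes. *)
  assert (Horth : forall x, inner n x = 0 -> inner d x = 0).
  { intros x Hx.
    assert (H := cross_cross d n x); rewrite Hdn, Hx in H.
    apply (f_equal (fun y => inner y n)) in H; revert H; inner_lin.
    rewrite Hnn.
    assert (H0 : cross zero x = zero) by vec_ring.
    rewrite H0, inner_zero_l; lra. }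
  repeat split.
  - apply Horth; rewrite inner_sym; apply inner_cross_l.
  - apply Horth; rewrite inner_sym; apply inner_cross_r.
  (* The moment of [e'] about the first striction point is [k] times [ch e + sh t], which has square
     1. Pairing with that vector isolates [k] on the right and [<d,g>] on the left. *)
  - assert (Hd : cross d e' = scal k (plus (scal ch e) (scal sh t))).
    { assert (H : cross d e' = plus (cross c' e') (opp (cross c e')))
        by (unfold d; vec_ring).
      rewrite H, Hk, He'; vec_ring. }
    apply (f_equal (fun y => inner y (plus (scal ch e) (scal sh t)))) in Hd.
    assert (Hl : inner (cross d e') (plus (scal ch e) (scal sh t))
                 = (ch * ch - sh * sh) * inner d (opp n))
      by (rewrite He'; unfold n; vec_ring).
    rewrite Hl, Hch in Hd; revert Hd; inner_lin.
    rewrite Hee, Htt, (inner_sym t), Het.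
    intros Hd; transitivity (k * (ch * ch - sh * sh)); [lra |].
    rewrite Hch; ring.
Qed.

(** If [h s] were nonzero, [h] would be nonzero near [s] by continuity; then [f] would vanish near
    [s], against its nonzero derivative. *)
Lemma vanishing_at_simple_zero (h f : R -> R) (s l : R) :
  continuous h s -> is_derive f s l -> l <> 0 ->
  locally s (fun u => f u <> 0 -> h u = 0) -> h s = 0.
Proof.
  intros Hh Hf Hl Hloc.
  destruct (Req_dec (h s) 0) as [| Hs]; [assumption | exfalso].
  assert (Hn : locally s (fun u => h u <> 0)).
  { exact (Hh _ (open_neq 0 (h s) Hs)). }
  apply Hl; rewrite <- (is_derive_unique _ _ _ Hf).
  rewrite (Derive_ext_loc _ (fun _ => 0)); [apply Derive_const |].
  apply (fun H => filter_imp _ _ H (filter_and _ _ Hloc Hn)).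
  intros u (H1 & H2).
  destruct (Req_dec (f u) 0) as [| H]; [assumption |].
  now elim H2; apply H1.
Qed.

(** All the geometry reduced to scalar identities. The last two serve the zeros of [theta]:
    [sinh theta] is differentiated as [<e1,e>], whose smoothness comes from the surfaces. *)
Lemma offset_relations
  (phi phi1 : ruled_surface)
  (gamma sigma theta thetastar : R -> R)
  (Hphi : spacelike_ruled phi)
  (Hgamma : conical_curvature phi gamma)
  (Hphi1 : timelike_ruled phi1)
  (Hoffset : mannheim_offset phi phi1 sigma)
  (Hangle : dual_offset_angle phi phi1 sigma (fun s => (theta s, thetastar s)))
  (s : R) (Hs : param_domain phi s) :
  Derive sigma s = gamma s * cosh (theta s) /\
  Derive sigma s * Defs.Delta phi1 (sigma s)
    = cosh (theta s) * delta phi s - sinh (theta s) * (gamma s * thetastar s) /\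
  inner (ruling phi1 (sigma s)) (ruling phi s) = sinh (theta s) /\
  is_derive (fun u => inner (ruling phi1 (sigma u)) (ruling phi u)) s
    (- cosh (theta s)).
Proof.
  destruct Hphi as (Hreg & HS), Hphi1 as (Hreg1 & HS1).
  destruct Hoffset as ((Hmap & _ & Hsig) & Hg).
  assert (Het : forall u, param_domain phi u -> inner (ruling phi u) (tvec phi u) = 0).
  { intros u Hu; apply (inner_e_t phi 1 u Hreg); [apply HS | exact Hu]. }
  assert (Hframe : forall u, param_domain phi u ->
    ruling phi1 (sigma u) = plus (scal (sinh (theta u)) (ruling phi u))
                                 (scal (cosh (theta u)) (tvec phi u)) /\
    (let d := plus (striction phi1 (sigma u)) (opp (striction phi u)) in
     inner d (ruling phi u) = 0 /\ inner d (tvec phi u) = 0 /\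
     inner d (gvec phi u) = thetastar u)).
  { intros u Hu.
    destruct (dual_combination _ _ _ _ _ (proj1 (Hangle u Hu))) as (A & B).
    cbn [fst snd dual_ext dual_e dual_t dual_line] in A, B.
    rewrite Derive_sinh, Derive_cosh in B.
    split; [exact A |].
    destruct (HS u Hu) as (Hee & Htt & _).
    apply (frame_displacement _ _ _ _ _ _ _ _ Hee Htt (Het u Hu)
             (cosh_sqr_minus_sinh_sqr (theta u)) A); [| exact B].
    assert (H1 := f_equal fst (Hg u Hu)); assert (H2 := f_equal snd (Hg u Hu)).
    cbn [fst snd dual_g dual_t dual_line] in H1, H2.
    rewrite <- H1 in H2; symmetry; exact H2. }
  assert (Ht1 : tvec phi1 (sigma s) = gvec phi s)
    by (symmetry; exact (f_equal fst (Hg s Hs))).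
  assert (Hg1 : gvec phi1 (sigma s) = plus (scal (cosh (theta s)) (ruling phi s))
                                           (scal (sinh (theta s)) (tvec phi s)))
    by exact (proj1 (dual_combination _ _ _ _ _ (proj2 (Hangle s Hs)))).
  destruct (HS s Hs) as (Hee & Htt & Hct).
  destruct (Hframe s Hs) as (He1 & _ & _ & Hk).
  destruct (Hgamma s Hs) as (Dt & Dg).
  destruct Hreg as (HI & Hc & He), Hreg1 as (_ & Hc1 & He1c).
  assert (Hloc := open_interval_locally _ s HI Hs).
  assert (De := vclass_C_derive 2 _ _ s (Nat.le_succ_diag_r 1) He Hs).
  fold (tvec phi s) in De.
  assert (Det : is_vderive (tvec phi) s (plus (ruling phi s) (scal (gamma s) (gvec phi s)))).
  { rewrite <- Dt; exact (vclass_C_vDerive 2 _ _ (le_n 2) He s Hs). }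
  assert (Deg : is_vderive (gvec phi) s (scal (gamma s) (tvec phi s))).
  (* The product rule supplies differentiability; the value is then replaced by the one in
     [conical_curvature]. *)
  { assert (H : is_vderive (gvec phi) s _) by exact (is_vderive_opp_cross _ _ _ _ _ De Det).
    rewrite <- Dg, (is_vderive_unique _ _ _ H); exact H. }
  assert (Dsig : is_derive sigma s (Derive sigma s)) by apply Derive_correct, Hsig, Hs.
  assert (Dd : is_vderive
    (fun u => plus (striction phi1 (sigma u)) (opp (striction phi u))) s
    (plus (scal (Derive sigma s) (vDerive (striction phi1) (sigma s)))
          (opp (vDerive (striction phi) s)))).
  { apply is_vderive_minus.
    - apply (is_vderive_comp (striction phi1)); [| exact Dsig].
      exact (vclass_C_derive 1 _ _ _ (le_n 1) Hc1 (Hmap s Hs)).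
    - exact (vclass_C_derive 1 _ _ _ (le_n 1) Hc Hs). }
  (* By the chain rule [e1] has derivative [sigma' t1], and [t1 = g]. *)
  assert (De1 : is_vderive (fun u => ruling phi1 (sigma u)) s
                  (scal (Derive sigma s) (gvec phi s))).
  { rewrite <- Ht1.
    apply (is_vderive_comp (ruling phi1)); [| exact Dsig].
    exact (vclass_C_derive 2 _ _ _ (Nat.le_succ_diag_r 1) He1c (Hmap s Hs)). }
  assert (Hgg : inner (gvec phi s) (gvec phi s) = 1).
  { unfold gvec; inner_lin.
    rewrite inner_cross_cross, Hee, Htt, (inner_sym (tvec phi s)), (Het s Hs); ring. }
  assert (Heg : forall u, inner (ruling phi u) (gvec phi u) = 0).
  { intros u; unfold gvec; rewrite inner_opp_r, inner_cross_l; ring. }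
  assert (Htg : forall u, inner (tvec phi u) (gvec phi u) = 0).
  { intros u; unfold gvec; rewrite inner_opp_r, inner_cross_r; ring. }
  split; [| split; [| split]].
  - assert (He1g : forall u, param_domain phi u ->
      inner (ruling phi1 (sigma u)) (gvec phi u) = 0).
    { intros u Hu; rewrite (proj1 (Hframe u Hu)); inner_lin.
      rewrite Heg, Htg; ring. }
    (* This reads [sigma' <g,g> + gamma <e1,t> = 0], where [<e1,t> = - cosh theta] since [t] is
       timelike. *)
    assert (H := derive_inner_const _ _ _ s 0 _ _ Hloc He1g De1 Deg).
    cbv beta in H; rewrite He1 in H; revert H; inner_lin.
    rewrite Hgg, Htt, (Het s Hs); lra.
  - assert (H1 := derive_inner_const _ _ _ s 0 _ _ Hloc
      (fun u Hu => proj1 (proj2 (Hframe u Hu))) Dd De).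
    assert (H2 := derive_inner_const _ _ _ s 0 _ _ Hloc
      (fun u Hu => proj1 (proj2 (proj2 (Hframe u Hu)))) Dd Det).
    cbv beta in H1, H2.
    rewrite (proj1 (proj2 (proj2 (Hframe s Hs)))) in H1.
    rewrite inner_plus_r, inner_scal_r, Hk in H2.
    rewrite (proj1 (proj2 (Hframe s Hs))) in H2.
    rewrite inner_plus_l, inner_opp_l, inner_scal_l in H1, H2.
    rewrite Hct in H2; fold (delta phi s) in H1.
    rewrite Delta_inner_gvec, Hg1; inner_lin.
    (* The differentiated relations say [sigma' X = delta] and [sigma' Y = - gamma thetastar], while
       [Delta1 = cosh theta X + sinh theta Y]. *)
    set (X := inner (vDerive (striction phi1) (sigma s)) (ruling phi s)) in *.
    set (Y := inner (vDerive (striction phi1) (sigma s)) (tvec phi s)) in *.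
    transitivity (cosh (theta s) * (Derive sigma s * X)
                  + sinh (theta s) * (Derive sigma s * Y)); [ring |].
    replace (Derive sigma s * X) with (delta phi s) by lra.
    replace (Derive sigma s * Y) with (- (gamma s * thetastar s)) by lra.
    ring.
  - rewrite He1; inner_lin.
    rewrite Hee, (inner_sym (tvec phi s)), (Het s Hs); ring.
  (* The derivative is [sigma' <g,e> + <e1,t>], and [<g,e> = 0]. *)
  - assert (H := is_derive_inner _ _ _ _ _ De1 De).
    evar_last; [exact H |]; cbv beta.
    rewrite He1; inner_lin.
    rewrite (inner_sym (gvec phi s)), Heg, (Het s Hs), Htt; ring.
Qed.

(** * Developability against the formula for the offset distance *)

Theorem corollary5p4
  (phi phi1 : ruled_surface)
  (gamma : R -> R) (sigma : R -> R) (theta thetastar : R -> R)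
  (Hphi : spacelike_ruled phi)
  (Hgamma : conical_curvature phi gamma)
  (Hphi1 : timelike_ruled phi1)
  (Hoffset : mannheim_offset phi phi1 sigma)
  (Hangle : dual_offset_angle phi phi1 sigma (fun s => (theta s, thetastar s))) :
  developable phi1 <->
  (forall s : R, param_domain phi s -> theta s <> 0 ->
     thetastar s = delta phi s / gamma s * coth (theta s)).
Proof.
  assert (Hrel := offset_relations _ _ _ _ _ _ Hphi Hgamma Hphi1 Hoffset Hangle).
  destruct Hoffset as ((Hmap & Hsurj & Hsig) & _).
  assert (Hpt : forall s, param_domain phi s -> theta s <> 0 ->
    (Defs.Delta phi1 (sigma s) = 0 <->
     thetastar s = delta phi s / gamma s * coth (theta s))).
  { intros s Hs Hth.
    destruct (Hrel s Hs) as (R1 & R2 & _), (Hsig s Hs) as (_ & Hne).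
    assert (Hsh : sinh (theta s) <> 0) by (intros H; apply Hth, sinh_eq_0, H).
    (* A zero of [gamma] would make [sigma' = gamma cosh theta] vanish. *)
    assert (Hga : gamma s <> 0) by (intros H; rewrite H in R1; apply Hne; lra).
    unfold coth; split; intros H.
    - rewrite H, Rmult_0_r in R2.
      apply (Rmult_eq_reg_l (sinh (theta s) * gamma s));
        [| now apply Rmult_integral_contrapositive].
      transitivity (cosh (theta s) * delta phi s); [lra | field; now split].
    - apply (Rmult_eq_reg_l (Derive sigma s)); [| exact Hne].
      rewrite R2, H; field; now split. }
  rewrite (timelike_developable phi1 Hphi1); split.
  - intros HD s Hs Hth; apply Hpt; [exact Hs | exact Hth |].
    apply HD, Hmap, Hs.
  - intros Hform s1 Hs1; destruct (Hsurj s1 Hs1) as (s & Hs & <-).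
    (* The formula is silent where [theta = 0], so [Delta1] is reached by continuity. The auxiliary
       function is [<e1,e> = sinh theta]: where it is nonzero, the formula applies and gives
       [Delta1 = 0]. *)
    apply (vanishing_at_simple_zero (fun u => Defs.Delta phi1 (sigma u))
             (fun u => inner (ruling phi1 (sigma u)) (ruling phi u)) s
             (- cosh (theta s))).
    + apply (continuous_comp sigma (Defs.Delta phi1)).
      * exact (ex_derive_continuous sigma s (proj1 (Hsig s Hs))).
      * apply regular_surface_Delta_continuous; [apply Hphi1 | exact Hs1].
    + apply Hrel, Hs.
    + apply Ropp_neq_0_compat, cosh_neq_0.
    + apply (filter_imp (param_domain phi)).
      * intros u Hu; rewrite (proj1 (proj2 (proj2 (Hrel u Hu)))); intros Hsh.
        assert (Hth : theta u <> 0)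
          by (intros H; apply Hsh; rewrite H; apply sinh_0).
        now apply (Hpt u Hu Hth), Hform.
      * apply open_interval_locally; [apply Hphi | exact Hs].
Qed.
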